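(* Let $S$ be a semigroup with zero and let $x\in Z(S)^{*}$. Then the out-degree of $x$ in $\overrightarrow{\Gamma}(S)$ is $|\mathrm{Ann}_{r}(x)\setminus\{0,x\}|$, and the in-degree of $x$ in $\overrightarrow{\Gamma}(S)$ is $|\mathrm{Ann}_{l}(x)\setminus\{0,x\}|$. If $Z(S)\neq S$, then the out-degrees of $x$ in $\overrightarrow{\Gamma}_{E}(S)$ and in $\overrightarrow{\mathrm{AG}}(S)$ are bounded below by $|\mathrm{Ann}_{r}(x)\setminus\{0,x\}|$, and the in-degrees of $x$ in $\overrightarrow{\Gamma}_{E}(S)$ and in $\overrightarrow{\mathrm{AG}}(S)$ are bounded below by $|\mathrm{Ann}_{l}(x)\setminus\{0,x\}|$.
   Context: Let $S$ be a semigroup with zero, not necessarily commutative; for $A\subseteq S$, $A^{*}=A\setminus\{0\}$. An element $x\in S$ is a left (resp. right) zero divisor if $xy=0$ (resp. $yx=0$) for some $y\in S^{*}$; $Z(S)$ is the set of all elements that are left or right zero divisors. For $x\in S$, $\mathrm{Ann}_{l}(x)=\{s\in S: sx=0\}$ and $\mathrm{Ann}_{r}(x)=\{s\in S: xs=0\}$. The following are simple digraphs (no loops, no multiple arcs), all with vertex set $Z(S)^{*}$; for distinct $x,y\in Z(S)^{*}$: in the zero-divisor digraph $\overrightarrow{\Gamma}(S)$, $x\to y$ is an arc iff $xy=0$; in the extended zero-divisor digraph $\overrightarrow{\Gamma}_{E}(S)$, $x\to y$ is an arc iff $x^{n}y^{m}=0$ for some positive integers $n,m$ with $x^{n}\neq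 0$ and $y^{m}\neq 0$; in the annihilator digraph $\overrightarrow{\mathrm{AG}}(S)$, $x\to y$ is an arc iff $\mathrm{Ann}_{l}(xy)\setminus(\mathrm{Ann}_{l}(x)\cup\mathrm{Ann}_{l}(y))\neq\emptyset$ or $\mathrm{Ann}_{r}(xy)\setminus(\mathrm{Ann}_{r}(x)\cup\mathrm{Ann}_{r}(y))\neq\emptyset$. The out-degree (in-degree) of a vertex is the number (cardinality) of arcs leaving (entering) it. *)

(* Defs.v *)
From HB Require Import structures.
From mathcomp Require Import all_boot.
From mathcomp Require Import boolp classical_sets functions cardinality.

Set Implicit Arguments.
Unset Strict Implicit.
Unset Printing Implicit Defensive.

Local Open Scope group_scope.
Local Open Scope classical_set_scope.

(* Simple digraphs on possibly infinite vertex sets: [arcs] being a set of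
   ordered pairs, there are no multiple arcs. *)
Record digraph (T : Type) := Digraph {
  vertices : set T;
  arcs : set (T * T);
  arcs_vertices : arcs `<=` vertices `*` vertices;
  arcs_loopless : forall x, ~ arcs (x, x)
}.

Section DigraphOn.
Variables (T : Type) (V : set T) (R : T -> T -> Prop).

Definition arcs_on : set (T * T) :=
  [set e | [/\ V e.1, V e.2, e.1 <> e.2 & R e.1 e.2]].

Fact arcs_on_vertices : arcs_on `<=` V `*` V.
Proof. by move=> e []. Qed.

Fact arcs_on_loopless x : ~ arcs_on (x, x).
Proof. by case. Qed.

Definition digraph_on : digraph T := Digraph arcs_on_vertices arcs_on_loopless.

End DigraphOn.

(* The out-degree (in-degree) of a vertex is the cardinality of the following
   sets; degrees are compared through [#=] and [#<=], as they may be infinite. *)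
Definition out_arcs (T : Type) (G : digraph T) (x : T) : set (T * T) :=
  [set e | arcs G e /\ e.1 = x].

Definition in_arcs (T : Type) (G : digraph T) (x : T) : set (T * T) :=
  [set e | arcs G e /\ e.2 = x].

HB.mixin Record Semigroup_hasZero S of Semigroup S := {
  zeros : S;
  mul0s : left_zero zeros (@mul S);
  muls0 : right_zero zeros (@mul S)
}.

#[short(type="semigroup0Type")]
HB.structure Definition Semigroup0 := {S of Semigroup S & Semigroup_hasZero S}.

Section Semigroup0Defs.
Variable S : semigroup0Type.
Implicit Types (x y : S) (A : set S).

Definition nonzero A : set S := A `\ (zeros : S).

Definition left_zero_divisor x := exists2 y, nonzero setT y & x * y = zeros.
Definition right_zero_divisor x := exists2 y, nonzero setT y & y * x = zeros.

Definition zero_divisors : set S :=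
  [set x | left_zero_divisor x \/ right_zero_divisor x].

Definition Annl x : set S := [set s | s * x = zeros].
Definition Annr x : set S := [set s | x * s = zeros].

(* A semigroup has no unit, so the [^+] of monoids is not available; the
   meaningful case is 0 < n, with the junk value spow x 0 = x. *)
Definition spow x (n : nat) : S := iterop n mul x x.

Definition zd_digraph : digraph S :=
  digraph_on (nonzero zero_divisors) (fun x y => x * y = zeros).

Definition ext_zd_digraph : digraph S :=
  digraph_on (nonzero zero_divisors) (fun x y => exists n m : nat,
    [/\ (0 < n)%N, (0 < m)%N, spow x n * spow y m = zeros,
        spow x n <> zeros & spow y m <> zeros]).

Definition ann_digraph : digraph S :=
  digraph_on (nonzero zero_divisors) (fun x y =>
    Annl (x * y) `\` (Annl x `|` Annl y) !=set0 \/
    Annr (x * y) `\` (Annr x `|` Annr y) !=set0).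

End Semigroup0Defs.

Arguments zero_divisors S : clear implicits.
Arguments zd_digraph S : clear implicits.
Arguments ext_zd_digraph S : clear implicits.
Arguments ann_digraph S : clear implicits.

(* Main.v *)
Require Import Defs.
From HB Require Import structures.
From mathcomp Require Import all_boot.
From mathcomp Require Import boolp classical_sets functions cardinality.

Local Open Scope classical_set_scope.
Local Open Scope card_scope.

(** An arc leaving [x] is determined by its head, so the out-degree of [x] in
    the zero-divisor digraph counts the heads [y], and [x * y = 0] means
    [y \in Annr x].  Conversely, every [y] in [Annr x] other than [0] and [x]
    is a head: since [x] is nonzero, the equation [x * y = 0] itself makes [y]
    a zero divisor, hence a vertex.  In-degrees are dual.

    The lower bounds hold because the zero-divisor digraph is a subdigraph of
    the other two ([sub_zd_ext_zd], [sub_zd_ann]).  For the extended digraph,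
    take both exponents equal to 1.  For the annihilator digraph, if [x * y = 0]
    then [Annl (x * y)] is the whole of [S], while any [s] outside
    [zero_divisors S] annihilates neither [x] nor [y]. *)

Section ArcsOfDigraphs.
Variable T : Type.
Implicit Types (G H : digraph T) (x : T).

Lemma card_out_arcs G x : out_arcs G x #= [set y | arcs G (x, y)].
Proof.
have -> : out_arcs G x = pair x @` [set y | arcs G (x, y)].
  apply/seteqP; split => [[a b] [/= Gab <-]|_ [y Gxy <-]] //.
  by exists b.
by apply: inj_card_eq => y z _ _ [].
Qed.

Lemma card_in_arcs G x : in_arcs G x #= [set y | arcs G (y, x)].
Proof.
have -> : in_arcs G x = pair^~ x @` [set y | arcs G (y, x)].
  apply/seteqP; split => [[a b] [/= Gab <-]|_ [y Gyx <-]] //.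
  by exists a.
by apply: inj_card_eq => y z _ _ [].
Qed.

Lemma sub_out_arcs G H x :
  arcs G `<=` arcs H -> out_arcs G x `<=` out_arcs H x.
Proof. by move=> sGH e [/sGH]. Qed.

Lemma sub_in_arcs G H x :
  arcs G `<=` arcs H -> in_arcs G x `<=` in_arcs H x.
Proof. by move=> sGH e [/sGH]. Qed.

End ArcsOfDigraphs.

Section ZeroDivisorDigraphs.
Variable S : semigroup0Type.
Implicit Types (x y s : S).

Lemma zd_out_neighbours x : nonzero (zero_divisors S) x ->
  [set y | arcs (zd_digraph S) (x, y)] = Annr x `\` [set zeros; x].
Proof.
move=> [Zx x0]; apply/seteqP; split=> y /=.
  case=> /= _ [_ y0] xy xy0; split=> // -[] // yx.
  exact: xy.
move=> [xy0 /not_orP[y0 yx]]; split=> //=; last exact/nesym.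
by split=> //; right; exists x.
Qed.

Lemma zd_in_neighbours x : nonzero (zero_divisors S) x ->
  [set y | arcs (zd_digraph S) (y, x)] = Annl x `\` [set zeros; x].
Proof.
move=> [Zx x0]; apply/seteqP; split=> y /=.
  by case=> /= -[_ y0] _ yx yx0; split=> // -[].
move=> [yx0 /not_orP[y0 yx]]; split=> //=.
by split=> //; left; exists x.
Qed.

Lemma sub_zd_ext_zd : arcs (zd_digraph S) `<=` arcs (ext_zd_digraph S).
Proof.
move=> [x y] [/= Zx Zy xy xy0]; split=> //=; exists 1%N, 1%N.
by case: Zx Zy => [_ x0] [_ y0].
Qed.

(** An element [s] that is not a zero divisor annihilates [0] only.  Hence one
    such [s] lies in [Annl (x * y)] but in neither [Annl x] nor [Annl y],
    whatever the arc [x -> y] of the zero-divisor digraph. *)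
Lemma sub_zd_ann : zero_divisors S <> [set: S] ->
  arcs (zd_digraph S) `<=` arcs (ann_digraph S).
Proof.
move=> ZS [x y] [/= [Zx x0] [Zy y0] xy xy0]; split=> //=; left.
have [s Zs] : exists s, ~ zero_divisors S s.
  apply/existsNP => allZ; apply: ZS.
  by apply/seteqP; split=> // s _; apply: allZ.
exists s; split; first by rewrite /Annl /= xy0 muls0.
by case=> sz0; apply: Zs; left; [exists x | exists y].
Qed.

End ZeroDivisorDigraphs.

Theorem lemma5p4 (S : semigroup0Type) (x : S)
    (hx : nonzero (zero_divisors S) x) :
  [/\ out_arcs (zd_digraph S) x #= Annr x `\` [set zeros; x],
      in_arcs (zd_digraph S) x #= Annl x `\` [set zeros; x] &
      zero_divisors S <> [set: S] ->
      [/\ Annr x `\` [set zeros; x] #<= out_arcs (ext_zd_digraph S) x,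
          Annr x `\` [set zeros; x] #<= out_arcs (ann_digraph S) x,
          Annl x `\` [set zeros; x] #<= in_arcs (ext_zd_digraph S) x &
          Annl x `\` [set zeros; x] #<= in_arcs (ann_digraph S) x]].
Proof.
have outE : out_arcs (zd_digraph S) x #= Annr x `\` [set zeros; x].
  by rewrite -zd_out_neighbours //; apply: card_out_arcs.
have inE : in_arcs (zd_digraph S) x #= Annl x `\` [set zeros; x].
  by rewrite -zd_in_neighbours //; apply: card_in_arcs.
split=> // ZS; split.
- rewrite -(card_le_eql outE).
  exact/subset_card_le/sub_out_arcs/sub_zd_ext_zd.
- rewrite -(card_le_eql outE).
  exact/subset_card_le/sub_out_arcs/sub_zd_ann.
- rewrite -(card_le_eql inE).
  exact/subset_card_le/sub_in_arcs/sub_zd_ext_zd.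
- rewrite -(card_le_eql inE).
  exact/subset_card_le/sub_in_arcs/sub_zd_ann.
Qed.
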